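(* Let $\mathbb{K}$ be a semiring, $(\Sigma,M)$ an OP alphabet, and $S:(\Sigma,M)^+\to K$ a series. Then $S$ is strictly regular if and only if $S\in\mathcal{N}(\Sigma,M,\mathbb{K})$.
   Context: A semiring $\mathbb{K}=(K,+,\cdot,0,1)$ has $(K,+,0)$ a commutative monoid, $(K,\cdot,1)$ a monoid, both distributive laws, and $0\cdot x=x\cdot 0=0$; multiplication need not be commutative. OP alphabets. An OP alphabet is a pair $(\Sigma,M)$ where $\Sigma$ is a finite alphabet, $\#\notin\Sigma$, and $M$ (the operator precedence matrix, OPM) assigns to each ordered pair of symbols of $\Sigma\cup\{\#\}$ at most one of the relations $\lessdot,\doteq,\gtrdot$ (an entry may be empty); we write $a\lessdot b$, $a\doteq b$, $a\gtrdot b$. Always $\#\lessdot a$ and $a\gtrdot\#$ for all $a\in\Sigma$. For $w=a_1\cdots a_n\in\Sigma^+$ put $a_0=a_{n+1}=\#$. The chain relation $\curvearrowright$ on $\{0,\dots,n+1\}$ is defined inductively: for $i<j$, $i\curvearrowright j$ if there are positions $i=k_1<\dots<k_m=j$ with $a_{k_1}\lessdot a_{k_2}\doteq\dots\doteq a_{k_{m-1}}\gtrdot a_{k_m}$ and, for each $s\in\{1,\dots,m-1\}$, either $k_s+1=k_{s+1}$ or $k_s\curvearrowright k_{s+1}$. The word $w$ is compatible with $M$ if $0\curvearrowright n+1$; $(\Sigma,M)^+$ is the set of all non-empty words over $\Sigma$ compatible with $M$. Automata. A (nondeterministic) OPA over $(\Sigma,M)$ is $(Q,I,F,\delta)$ with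 $Q$ a finite set of states, $I,F\subseteq Q$ (initial, final), and $\delta=(\delta_{\mathrm{shift}},\delta_{\mathrm{push}},\delta_{\mathrm{pop}})$, $\delta_{\mathrm{shift}},\delta_{\mathrm{push}}\subseteq Q\times\Sigma\times Q$, $\delta_{\mathrm{pop}}\subseteq Q\times Q\times Q$. A weighted OPA (wOPA) over $(\Sigma,M)$ and $\mathbb{K}$ is $\mathcal{A}=(Q,I,F,\delta,\mathrm{wt})$ with $(Q,I,F,\delta)$ an OPA and $\mathrm{wt}=(\mathrm{wt}_{\mathrm{shift}},\mathrm{wt}_{\mathrm{push}},\mathrm{wt}_{\mathrm{pop}})$, $\mathrm{wt}_{op}:\delta_{op}\to K$. It is restricted (an rwOPA) if $\mathrm{wt}_{\mathrm{pop}}\equiv 1$. A configuration is $\langle\Pi,q,u\#,k\rangle$ with stack $\Pi\in\bot(\Sigma\times Q)^*$, state $q$, remaining input $u\#$, and $k\in K$. With $a$ the topmost alphabet symbol of the stack ($a=\#$ if the stack is $\bot$) and $b$ the next input symbol, moves are: push: $\langle\Pi,q,bx,k\rangle\vdash\langle\Pi[b,q],r,x,k\cdot\mathrm{wt}_{\mathrm{push}}(q,b,r)\rangle$ if $a\lessdot b$, $(q,b,r)\in\delta_{\mathrm{push}}$; shift: $\langle\Pi[a,p],q,bx,k\rangle\vdash\langle\Pi[b,p],r,x,k\cdot\mathrm{wt}_{\mathrm{shift}}(q,b,r)\rangle$ if $a\doteq b$, $(q,b,r)\in\delta_{\mathrm{shift}}$; pop: $\langle\Pi[a,p],q,bx,k\rangle\vdash\langle\Pi,r,bx,k\cdot\mathrm{wt}_{\mathrm{pop}}(q,p,r)\rangle$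 if $a\gtrdot b$, $(q,p,r)\in\delta_{\mathrm{pop}}$. An accepting run on $w$ is a finite sequence of moves from $\langle\bot,q_I,w\#,1\rangle$ to $\langle\bot,q_F,\#,k\rangle$ with $q_I\in I$, $q_F\in F$; its weight is $\mathrm{wt}(\rho)=k$. The behavior is $[\![\mathcal{A}]\!]:(\Sigma,M)^+\to K$, $[\![\mathcal{A}]\!](w)=\sum_{\rho}\mathrm{wt}(\rho)$, summed over all accepting runs $\rho$ of $\mathcal{A}$ on $w$. Runs of an unweighted OPA are the same with weights ignored; its language is the set of words in $(\Sigma,M)^+$ with an accepting run, and $L\subseteq(\Sigma,M)^+$ is an OPL (over $(\Sigma,M)$) if it is the language of some OPA over $(\Sigma,M)$. A series is a function $S:(\Sigma,M)^+\to K$; it is strictly regular if $S=[\![\mathcal{A}]\!]$ for some rwOPA $\mathcal{A}$ over $(\Sigma,M)$ and $\mathbb{K}$. Nivat class. For a map $h:\Sigma'\to\Sigma$ between finite alphabets, $h^{-1}(M)$ is the OPM on $\Sigma'$ with $h^{-1}(M)_{a'b'}=M_{h(a')h(b')}$ for $a',b'\in\Sigma'$ (and the standard relations for $\#$); $h$ extends letterwise to $h:(\Sigma',h^{-1}(M))^+\to(\Sigma,M)^+$. For a series $T:(\Sigma',h^{-1}(M))^+\to K$ let $h(T):(\Sigma,M)^+\to K$, $h(T)(v)=\sum_{w\in(\Sigma',h^{-1}(M))^+,\,h(w)=v}T(w)$. For a language $L$, $(T\cap L)(w)=T(w)$ if $w\in L$ and $0$ otherwise. $\mathcal{N}(\Sigma,M,\mathbb{K})$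 is the set of all series $S:(\Sigma,M)^+\to K$ for which there exist an alphabet $\Sigma'$, a map $h:\Sigma'\to\Sigma$, a one-state rwOPA $\mathcal{B}$ over $(\Sigma',h^{-1}(M))$ and $\mathbb{K}$, and an OPL $L$ over $(\Sigma',h^{-1}(M))$ such that $S=h([\![\mathcal{B}]\!]\cap L)$. *)

(* Defs.v *)
From HB Require Import structures.
From mathcomp Require Import all_boot all_order all_algebra.
From mathcomp Require Import zify.
From mathcomp Require Import boolp classical_sets functions cardinality fsbigop.

Set Implicit Arguments.
Unset Strict Implicit.
Unset Printing Implicit Defensive.

Import GRing.Theory.
Local Open Scope classical_set_scope.
Local Open Scope ring_scope.

Variant prec := Lessdot | Doteq | Gtrdot.

Definition prec_eqb (x y : prec) : bool :=
  match x, y with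
  | Lessdot, Lessdot | Doteq, Doteq | Gtrdot, Gtrdot => true
  | _, _ => false
  end.

Lemma prec_eqP : Equality.axiom prec_eqb.
Proof. by case; case; constructor. Qed.

HB.instance Definition _ := hasDecEq.Build prec prec_eqP.

(* The delimiter # is represented by [None : option Sigma]; an empty matrix
   entry is [None : option prec].  The entry for (#, #) is left arbitrary: it is
   used neither by the chain relation of a word nor by the moves of an
   automaton. *)
Record opm (Sigma : finType) := Opm {
  opm_entry :> option Sigma -> option Sigma -> option prec;
  opm_delim_left : forall a, opm_entry None (Some a) = Some Lessdot;
  opm_delim_right : forall a, opm_entry (Some a) None = Some Gtrdot
}.

Section Words.
Context {Sigma : finType}.
Implicit Types (M : opm Sigma) (w : seq Sigma).

Definition lessdot M (a b : option Sigma) : bool := M a b == Some Lessdot.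
Definition doteq M (a b : option Sigma) : bool := M a b == Some Doteq.
Definition gtrdot M (a b : option Sigma) : bool := M a b == Some Gtrdot.

(* The letters of w are numbered from 1; positions 0 and [(size w).+1] carry #. *)
Definition letter_at w (i : nat) : option Sigma :=
  if i is i'.+1 then onth w i' else None.

(* In [chain_intro], i, x, ks, j spell out the positions k_1 < ... < k_m:
   i = k_1, x = k_2, ks = [k_3; ...; k_(m-1)] and j = k_m (so that m >= 3). *)
Inductive chain M w : nat -> nat -> Prop :=
| chain_intro (i x : nat) (ks : seq nat) (j : nat) of
    path ltn i (x :: rcons ks j) &
    (j <= (size w).+1)%N &
    lessdot M (letter_at w i) (letter_at w x) &
    path (fun p q => doteq M (letter_at w p) (letter_at w q)) x ks &
    gtrdot M (letter_at w (last x ks)) (letter_at w j) &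
    (forall s : nat, (s.+1 < size (i :: x :: rcons ks j))%N ->
      let k := nth 0%N (i :: x :: rcons ks j) in
      (k s).+1 = k s.+1 \/ chain M w (k s) (k s.+1)) :
    chain M w i j.

Definition compatible M w : Prop := chain M w 0 (size w).+1.

Record opword M := OpWord {
  opword_seq :> seq Sigma;
  opwordP : (opword_seq != [::]) && `[< compatible M opword_seq >]
}.

HB.instance Definition _ M := [isSub for @opword_seq M].
HB.instance Definition _ M := [Choice of opword M by <:].

End Words.

Definition preim_opm (Sigma' Sigma : finType) (h : Sigma' -> Sigma)
    (M : opm Sigma) : opm Sigma' :=
  @Opm Sigma' (fun a b => M (omap h a) (omap h b))
    (fun a => opm_delim_left M (h a)) (fun a => opm_delim_right M (h a)).

Record opa (Sigma : finType) := Opa {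
  state : finType;
  init : {set state};
  final : {set state};
  delta_shift : {set state * Sigma * state};
  delta_push : {set state * Sigma * state};
  delta_pop : {set state * state * state}
}.

Section Runs.
Context {Sigma : finType} (M : opm Sigma) (A : opa Sigma).
Local Notation Q := (state A).

(* Stack with its top first (the bottom marker being implicit), current state,
   and remaining input without the final #. *)
Definition config := (seq (Sigma * Q) * Q * seq Sigma)%type.

Definition top (stack : seq (Sigma * Q)) : option Sigma :=
  ohead (map fst stack).

Variant transition :=
| Push of Q & Sigma & Q
| Shift of Q & Sigma & Q
| Pop of Q & Q & Q.

Variant move : config -> transition -> config -> Prop :=
| move_push stack q b r x of
    lessdot M (top stack) (Some b) & (q, b, r) \in delta_push A :
    move (stack, q, b :: x) (Push q b r) ((b, q) :: stack, r, x)
| move_shift stack a p q b r x of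
    doteq M (Some a) (Some b) & (q, b, r) \in delta_shift A :
    move ((a, p) :: stack, q, b :: x) (Shift q b r) ((b, p) :: stack, r, x)
| move_pop stack a p q r u of
    gtrdot M (Some a) (ohead u) & (q, p, r) \in delta_pop A :
    move ((a, p) :: stack, q, u) (Pop q p r) (stack, r, u).

(* A transition is determined by the configurations it links, so that a run may
   be identified with the sequence of configurations it visits. *)
Lemma move_inj c t t' c' : move c t c' -> move c t' c' -> t = t'.
Proof.
case=> [s q b r x _ _|s a p q b r x _ _|s a p q r u _ _] mv; inversion mv;
  subst => //.
all: by match goal with H : _ = _ |- _ => have /= := congr1 size H; lia end.
Qed.

Definition step (c c' : config) : Prop := exists t, move c t c'.

Definition language : set (opword M) :=
  [set w | exists (qI qF : Q) (cs : seq config),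
     [/\ qI \in init A, qF \in final A,
         path (fun c c' => `[< step c c' >]) ([::], qI, opword_seq w) cs
       & last ([::], qI, opword_seq w) cs = ([::], qF, [::])]].

End Runs.

Arguments Push {Sigma A}.
Arguments Shift {Sigma A}.
Arguments Pop {Sigma A}.
Arguments move {Sigma} M {A}.
Arguments step {Sigma} M {A}.
Arguments language {Sigma} M A.

Definition opl (Sigma : finType) (M : opm Sigma) (L : set (opword M)) : Prop :=
  exists A : opa Sigma, L = language M A.

(* The weight functions are total; only their values on the corresponding
   transition sets are ever used. *)
Record wopa (K : pzSemiRingType) (Sigma : finType) := Wopa {
  wopa_opa :> opa Sigma;
  wt_shift : state wopa_opa * Sigma * state wopa_opa -> K;
  wt_push : state wopa_opa * Sigma * state wopa_opa -> K;
  wt_pop : state wopa_opa * state wopa_opa * state wopa_opa -> K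
}.

Definition restricted (K : pzSemiRingType) (Sigma : finType)
    (A : wopa K Sigma) : Prop :=
  forall t, t \in delta_pop A -> wt_pop t = 1.

Definition series (K : pzSemiRingType) (Sigma : finType) (M : opm Sigma) :=
  opword M -> K.

Section Behavior.
Context {K : pzSemiRingType} {Sigma : finType} (M : opm Sigma).
Variable A : wopa K Sigma.

Definition wt (t : transition A) : K :=
  match t with
  | Push q b r => wt_push (q, b, r)
  | Shift q b r => wt_shift (q, b, r)
  | Pop q p r => wt_pop (q, p, r)
  end.

Definition wconfig := (config A * K)%type.

Definition wstep (c c' : wconfig) : Prop :=
  exists2 t, move M c.1 t c'.1 & c'.2 = c.2 * wt t.

(* The initial configuration of a run followed by the later ones. *)
Definition run := (wconfig * seq wconfig)%type.

Definition accepting_runs (w : opword M) : set run :=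
  [set rho | exists (qI qF : state A) (k : K),
     [/\ qI \in init A, qF \in final A,
         rho.1 = (([::], qI, opword_seq w), 1),
         path (fun c c' => `[< wstep c c' >]) rho.1 rho.2
       & last rho.1 rho.2 = (([::], qF, [::]), k)]].

Definition run_weight (rho : run) : K := (last rho.1 rho.2).2.

(* A finite sum, by [finite_accepting_runs] below. *)
Definition behavior : series K M :=
  fun w => \sum_(rho \in accepting_runs w) run_weight rho.

End Behavior.

Arguments wstep {K Sigma} M {A}.
Arguments accepting_runs {K Sigma M} A w.
Arguments behavior {K Sigma} M A.

Definition strictly_regular (K : pzSemiRingType) (Sigma : finType)
    (M : opm Sigma) (S : series K M) : Prop :=
  exists A : wopa K Sigma, restricted A /\ S = behavior M A.

(* A finite sum, by [finite_fiber] below. *)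
Definition series_image (K : pzSemiRingType) (Sigma' Sigma : finType)
    (h : Sigma' -> Sigma) (M : opm Sigma) (T : series K (preim_opm h M)) :
    series K M :=
  fun v => \sum_(w \in [set w : opword (preim_opm h M) |
                         map h w = opword_seq v]) T w.

Arguments series_image {K Sigma' Sigma} h {M} T _.

Definition series_restr (K : pzSemiRingType) (Sigma : finType) (M : opm Sigma)
    (T : series K M) (L : set (opword M)) : series K M :=
  fun w => if `[< L w >] then T w else 0.

Definition nivat (K : pzSemiRingType) (Sigma : finType) (M : opm Sigma)
    (S : series K M) : Prop :=
  exists (Sigma' : finType) (h : Sigma' -> Sigma) (B : wopa K Sigma')
         (L : set (opword (preim_opm h M))),
    [/\ restricted B, #|state B| = 1%N, opl L
      & S = series_image h (series_restr (behavior (preim_opm h M) B) L)].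

Lemma finite_fiber (Sigma' Sigma : finType) (h : Sigma' -> Sigma)
    (M : opm Sigma) (v : opword M) :
  finite_set [set w : opword (preim_opm h M) | map h w = opword_seq v].
Proof.
pose B := range (@tval (size v) Sigma').
have finB : finite_set B by exact/finite_image/finite_finset.
apply: (sub_finite_set (B := (@opword_seq _ (preim_opm h M)) @^-1` B)).
  move=> w /= hw; have sw : size w == size v by rewrite -hw size_map.
  by exists (Tuple sw).
by apply: finite_preimage finB => x y _ _; exact: val_inj.
Qed.

Section FiniteRuns.
Context {K : pzSemiRingType} {Sigma : finType} (M : opm Sigma).
Variable A : wopa K Sigma.
Local Notation wpath := (path (fun c c' : wconfig A => `[< wstep M c c' >])).

Lemma finite_wstep (c : wconfig A) : finite_set [set c' | wstep M c c'].
Proof.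
pose t1 r : wconfig A := (([::], r, [::]), 1).
case: c => [[[st q] u] k].
pose fpush r : wconfig A := if u is b :: x then
  (((b, q) :: st, r, x), k * wt (Push q b r)) else t1 r.
pose fshift r : wconfig A := match u, st with
  | b :: x, (a, p) :: st' => (((b, p) :: st', r, x), k * wt (Shift q b r))
  | _, _ => t1 r end.
pose fpop r : wconfig A := if st is (a, p) :: st' then
  ((st', r, u), k * wt (Pop q p r)) else t1 r.
apply: (sub_finite_set (B := range fpush `|` range fshift `|` range fpop)).
  move=> [c' k'] [t /= mv ->].
  inversion mv; subst; [left; left|left; right|right];
    by exists r => //; rewrite /fpush /fshift /fpop.
by rewrite !finite_setU; do !split; exact/finite_image/finite_finset.
Qed.

Lemma finite_wpath n (c : wconfig A) :
  finite_set [set s | size s = n /\ wpath c s].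
Proof.
elim: n c => [|n IHn] c.
  apply: (sub_finite_set (B := [set [::]])); last exact: finite_set1.
  by case=> [|? ?] [].
apply: (sub_finite_set (B := \bigcup_(c' in [set c' : wconfig A | wstep M c c'])
    (cons c' @` [set s | size s = n /\ wpath c' s]))).
  case=> [[]//|c' s] [/= [sn] /andP[/asboolP cc' ps]].
  by exists c' => //; exists s.
by apply: bigcup_finite; [exact: finite_wstep|move=> c' _; exact: finite_image].
Qed.

Definition config_measure (c : wconfig A) : nat :=
  ((size c.1.2).*2 + size c.1.1.1)%N.

Lemma wstep_measure (c c' : wconfig A) : wstep M c c' ->
  (config_measure c' < config_measure c)%N.
Proof.
case: c => [c k]; case: c' => [c' k'] [t /= mv _].
by case: mv => *; rewrite /config_measure /=; lia.
Qed.

Lemma wpath_size c s : wpath c s -> (size s <= config_measure c)%N.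
Proof.
elim: s c => [//|c' s IHs] c /= /andP[/asboolP /wstep_measure lt /IHs le].
by lia.
Qed.

Lemma finite_accepting_runs (w : opword M) : finite_set (accepting_runs A w).
Proof.
pose c0 q : wconfig A := (([::], q, opword_seq w), 1).
apply: (sub_finite_set (B := \bigcup_(q in [set: state A])
   \bigcup_(n in `I_(config_measure (c0 q)).+1)
     (pair (c0 q) @` [set s | size s = n /\ wpath (c0 q) s]))).
  move=> [c s] [qI [qF [k [/= _ _ -> ps _]]]].
  exists qI => //; exists (size s); last by exists s.
  by rewrite /= ltnS; exact: wpath_size.
apply: bigcup_finite => [|q _]; first exact: finite_finset.
apply: bigcup_finite => [|n _]; first exact: finite_II.
exact/finite_image/finite_wpath.
Qed.

End FiniteRuns.

(* Main.v *)
(* Both directions compare residual weights, i.e. sums of weights of the accepting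
   runs from a configuration, by induction on the length of the runs.

   From an automaton to the Nivat class: each pushed symbol is popped exactly
   once, so a run is determined by the word of its push and shift transitions,
   provided that every push also announces the target state of the matching pop.
   An OPA checks such words by guessing the announcement just before the push,
   when it can still be stored on the stack.

   From the Nivat class to an automaton: with a nondeterministic OPA for L, one
   word would be counted once per accepting run.  The subset construction on pairs
   (current state, topmost stack state) makes it deterministic, and the weights of
   the letters with a common image and a common target are added up; pops carry
   weight 1. *)
Require Import Defs.
From HB Require Import structures.
From mathcomp Require Import all_boot all_order all_algebra.
From mathcomp Require Import boolp classical_sets fsbigop.

Set Implicit Arguments.
Unset Strict Implicit.
Unset Printing Implicit Defensive.

Import GRing.Theory.
Local Open Scope ring_scope.

Lemma uniq_map_inj (T1 T2 : eqType) (f : T1 -> T2) (s : seq T1) :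
  uniq [seq f x | x <- s] -> {in s &, injective f}.
Proof.
elim: s => [|z s IHs] //= /andP[/mapP nfz /IHs inj] x y.
rewrite !inE => /orP[/eqP -> | xs] /orP[/eqP -> | ys] // fxy.
- by case: nfz; exists y.
- by case: nfz; exists x.
exact: inj.
Qed.

(** * Acceptance by an unweighted automaton, unfolded one move at a time *)

Section Acceptance.
Context {Sigma : finType} (M : opm Sigma) (A : opa Sigma).
Implicit Types (st : seq (Sigma * state A)) (c : config A).

(** A matrix entry holds at most one relation, so the relation between the stack top and the next
    symbol rules out the other two kinds of move. *)
Ltac prec_clash :=
  by unfold lessdot, doteq, gtrdot, top in *; simpl in *;
     repeat match goal with H : is_true (_ == _) |- _ => move/eqP: H => H end;
     congruence.

Inductive accepts : config A -> Prop :=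
| accepts_final q : q \in final A -> accepts ([::], q, [::])
| accepts_step c c' : step M c c' -> accepts c' -> accepts c.

Lemma languageP (w : opword M) :
  language M A w <->
  exists2 q, q \in init A & accepts ([::], q, opword_seq w).
Proof.
split=> [[qI [qF [cs [qIi qFf]]]]|[q qi acc]].
  move=> pcs lcs; exists qI => //; move: pcs lcs.
  elim: cs ([::], qI, opword_seq w) => [|c' cs IHcs] c /=.
    by move=> _ ->; exact: accepts_final.
  move=> /andP[/asboolP cc' pcs] /(IHcs _ pcs); exact: accepts_step.
suff [qF [cs [qFf pcs lcs]]]: exists qF cs, [/\ qF \in final A,
    path (fun c c' => `[< step M c c' >]) ([::], q, opword_seq w) cs
  & last ([::], q, opword_seq w) cs = ([::], qF, [::])].
  by exists q, qF, cs.
elim: acc => [q' q'f|c c' cc' _ [qF [cs [qFf pcs lcs]]]].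
  by exists q', [::].
by exists qF, (c' :: cs); split=> //=; rewrite pcs andbT; apply/asboolP.
Qed.

Lemma accepts_end q : accepts ([::], q, [::]) <-> q \in final A.
Proof.
split=> [acc|]; last exact: accepts_final.
by inversion acc as [|c c' [t mv]]; subst => //; inversion mv.
Qed.

Lemma accepts_push st q b x : lessdot M (top st) (Some b) ->
  accepts (st, q, b :: x) <->
  exists2 r, (q, b, r) \in delta_push A & accepts ((b, q) :: st, r, x).
Proof.
move=> lt; split=> [acc|[r qr acc]]; last first.
  by apply: accepts_step acc; exists (Push q b r); constructor.
inversion acc as [|c c' [t mv] acc']; subst.
by inversion mv; subst; first [by exists r | prec_clash].
Qed.

Lemma accepts_shift a p st q b x : doteq M (Some a) (Some b) ->
  accepts ((a, p) :: st, q, b :: x) <->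
  exists2 r, (q, b, r) \in delta_shift A & accepts ((b, p) :: st, r, x).
Proof.
move=> eq; split=> [acc|[r qr acc]]; last first.
  by apply: accepts_step acc; exists (Shift q b r); constructor.
inversion acc as [|c c' [t mv] acc']; subst.
by inversion mv; subst; first [by exists r | prec_clash].
Qed.

Lemma accepts_pop a p st q u : gtrdot M (Some a) (ohead u) ->
  accepts ((a, p) :: st, q, u) <->
  exists2 r, (q, p, r) \in delta_pop A & accepts (st, r, u).
Proof.
move=> gt; split=> [acc|[r qr acc]]; last first.
  by apply: accepts_step acc; exists (Pop q p r); constructor.
inversion acc as [|c c' [t mv] acc']; subst.
by inversion mv; subst; first [by exists r | prec_clash].
Qed.

End Acceptance.

(** * Residual weights and their relation to the behavior *)

Section Residual.
Context {K : pzSemiRingType} {Sigma : finType} (M : opm Sigma).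
Variable A : wopa K Sigma.
Implicit Types (st : seq (Sigma * state A)) (s : seq (wconfig A)).
Local Notation wpath := (path (fun c c' : wconfig A => `[< wstep M c c' >])).

(** Each move is listed with its own weight only, not the accumulated one. The kind of move is
    dictated by the matrix entry, so different targets [r] give different configurations. *)
Definition successors (c : config A) : seq (config A * K) :=
  let: (st, q, u) := c in
  match M (top st) (ohead u), st, u with
  | Some Lessdot, _, b :: x =>
      [seq (((b, q) :: st, r, x), wt_push (q, b, r)) |
        r <- enum (state A) & (q, b, r) \in delta_push A]
  | Some Doteq, (_, p) :: st', b :: x =>
      [seq (((b, p) :: st', r, x), wt_shift (q, b, r)) |
        r <- enum (state A) & (q, b, r) \in delta_shift A]
  | Some Gtrdot, (_, p) :: st', _ =>
      [seq ((st', r, u), wt_pop (q, p, r)) |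
        r <- enum (state A) & (q, p, r) \in delta_pop A]
  | _, _, _ => [::]
  end.

Definition accepting (c : config A) : bool :=
  let: (st, q, u) := c in [&& nilp st, nilp u & q \in final A].

(* The sum of the weights of the accepting runs of length at most n from c. *)
Fixpoint residual n (c : config A) : K :=
  (if accepting c then 1 else 0) +
  (if n is n'.+1 then \sum_(e <- successors c) e.2 * residual n' e.1 else 0).

Lemma wstepP (c c' : wconfig A) :
  reflect (exists2 e, e \in successors c.1 & c' = (e.1, c.2 * e.2))
          `[< wstep M c c' >].
Proof.
apply: (iffP (asboolP _)).
  case: c c' => c k [c' k'] [t /= mv ->].
  exists (c', wt t) => //.
  case: mv => [st q b r x|st a p q b r x|st a p q r u] /= /eqP Mab dr;
    by rewrite /successors /= Mab; apply/mapP; exists r;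
       rewrite // mem_filter dr mem_enum.
case: c => [[[st q] u] k] [e]; rewrite /successors /= => + ->.
case E: (M _ _) => [[]|] //.
- case: u E => [|b x] // E /mapP[r]; rewrite mem_filter => /andP[? _] ->.
  by exists (Push q b r) => //; constructor=> //; rewrite /lessdot E.
- case: st u E => [|[a p] st] [|b x] // E /mapP[r].
  rewrite mem_filter => /andP[? _] ->.
  by exists (Shift q b r) => //; constructor=> //; rewrite /doteq E.
- case: st E => [|[a p] st] // E /mapP[r]; rewrite mem_filter => /andP[? _] ->.
  by exists (Pop q p r) => //; constructor=> //; rewrite /gtrdot E.
Qed.

Lemma uniq_successors (c : config A) : uniq [seq e.1 | e <- successors c].
Proof.
case: c => [[st q] u]; rewrite /successors.
have enumU (P : pred (state A)) : uniq [seq r <- enum (state A) | P r].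
  exact/filter_uniq/enum_uniq.
by case: (M _ _) => [[]|]; case: st => [|[? ?] ?]; case: u => [|? ?] //=;
  rewrite -map_comp map_inj_uniq // => r r' [].
Qed.

(** Here the weights are accumulated along the run as in [wstep], so that these sequences are
    literally the tails of accepting runs; [residual] has the accumulated factor taken out. *)
Fixpoint runs_from n (c : wconfig A) : seq (seq (wconfig A)) :=
  (if accepting c.1 then [:: [::]] else [::]) ++
  (if n is n'.+1 then
     [seq (e.1, c.2 * e.2) :: s | e <- successors c.1,
                                  s <- runs_from n' (e.1, c.2 * e.2)]
   else [::]).

Lemma runs_from_sound n c s : s \in runs_from n c ->
  wpath c s && accepting (last c s).1.
Proof.
elim: n c s => [|n IHn] c s /=; rewrite mem_cat => /orP[].
- by case: ifP; rewrite ?inE // => acc /eqP ->.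
- by [].
- by case: ifP; rewrite ?inE // => acc /eqP ->.
move=> /allpairsPdep[e [s' [ein s'in ->]]] /=; rewrite -andbA IHn // andbT.
by apply/wstepP; exists e.
Qed.

Lemma runs_from_complete n c s : (size s <= n)%N ->
  wpath c s && accepting (last c s).1 -> s \in runs_from n c.
Proof.
elim: n c s => [|n IHn] c [|c' s] //= sn; rewrite mem_cat.
- by move=> ->.
- by move=> ->.
rewrite -andbA => /andP[/wstepP[e ein ->] ps]; apply/orP; right.
by apply/allpairsPdep; exists e, s; split=> //; exact: IHn.
Qed.

Lemma uniq_runs_from n c : uniq (runs_from n c).
Proof.
elim: n c => [|n IHn] c /=; first by case: ifP.
rewrite cat_uniq; apply/and3P; split; first by case: ifP.
  apply/hasPn => s /allpairsPdep[e [s' [_ _ ->]]].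
  by case: ifP; rewrite ?inE.
apply: allpairs_uniq_dep.
- exact/(@map_uniq _ _ fst)/uniq_successors.
- by move=> e _; exact: IHn.
move=> [e s] [e' s'] /allpairsPdep[f [t [fin _ [-> _]]]].
move=> /allpairsPdep[f' [t' [fin' _ [-> _]]]] /= [ff' _ ss'].
(* A successor is determined by its configuration, so its weight agrees as well. *)
have -> : f = f' by apply: (uniq_map_inj (uniq_successors _)) fin fin' ff'.
by rewrite ss'.
Qed.

(** Left distributivity pulls out the weight gathered so far; the order of the factors is kept, so
    commutativity is never called on. *)
Lemma sum_runs_from n c :
  \sum_(s <- runs_from n c) (last c s).2 = c.2 * residual n c.1.
Proof.
elim: n c => [|n IHn] c /=; rewrite big_cat /= mulrDr; congr (_ + _).
- by case: ifP => _; rewrite (big_seq1, big_nil) ?mulr1 ?mulr0.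
- by rewrite big_nil mulr0.
- by case: ifP => _; rewrite (big_seq1, big_nil) ?mulr1 ?mulr0.
rewrite big_allpairs_dep mulr_sumr; apply: eq_bigr => e _ /=.
by rewrite IHn mulrA.
Qed.

(** The bound is the measure of an initial configuration: two for each unread letter, none for the
    empty stack. Every move lowers the measure, so no accepting run is longer. *)
Lemma behaviorE (w : opword M) : behavior M A w =
  \sum_(q in init A) residual (size w).*2 ([::], q, opword_seq w).
Proof.
pose c0 q : wconfig A := (([::], q, opword_seq w), 1).
pose all_runs := [seq (c0 q, s) |
  q <- enum (init A), s <- runs_from (size w).*2 (c0 q)].
rewrite /behavior (_ : accepting_runs A w = [set` all_runs]%classic); last first.
  apply/seteqP; split=> [[c s] [qI [qF [k [/= qIi qFf -> ps ls]]]]|].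
    apply/allpairsPdep; exists qI, s; split=> //; rewrite ?mem_enum //.
    apply: runs_from_complete; last by rewrite ps ls /=.
    by have := wpath_size ps; rewrite /config_measure /= addn0.
  move=> rho /= /allpairsPdep[q [s [qi /runs_from_sound + ->]]].
  move=> /andP[ps]; rewrite mem_enum in qi.
  case ls: (last _ s) => [[[st qF] u] k] /= /and3P[/nilP st0 /nilP u0 qFf].
  by exists q, qF, k; split=> //; rewrite ls st0 u0.
rewrite -fsbig_seq; last first.
  apply: allpairs_uniq_dep; first exact: enum_uniq.
    by move=> q _; exact: uniq_runs_from.
  by move=> [q s] [q' s'] _ _ /= [-> ->].
rewrite big_allpairs_dep big_enum /=; apply: eq_bigr => q _.
by rewrite sum_runs_from mul1r.
Qed.

Lemma residual_end n q :
  residual n ([::], q, [::]) = if q \in final A then 1 else 0.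
Proof.
case: n => [|n] /=; first by rewrite addr0.
by case: (M _ _) => [[]|]; rewrite big_nil addr0.
Qed.

Lemma residual0 st q u : (st, u) <> ([::], [::]) ->
  residual 0 (st, q, u) = 0.
Proof. by case: st u => [|? ?] [|? ?] // _; rewrite /= addr0. Qed.

Lemma residual_push n st q b x : lessdot M (top st) (Some b) ->
  residual n.+1 (st, q, b :: x) =
  \sum_(r | (q, b, r) \in delta_push A)
    wt_push (q, b, r) * residual n ((b, q) :: st, r, x).
Proof.
rewrite /lessdot /= andbF => /eqP ->.
by rewrite big_map big_filter big_enum_cond /= add0r.
Qed.

Lemma residual_shift n a p st q b x : doteq M (Some a) (Some b) ->
  residual n.+1 ((a, p) :: st, q, b :: x) =
  \sum_(r | (q, b, r) \in delta_shift A)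
    wt_shift (q, b, r) * residual n ((b, p) :: st, r, x).
Proof.
rewrite /doteq /= => /eqP ->.
by rewrite big_map big_filter big_enum_cond /= add0r.
Qed.

Lemma residual_pop n a p st q u : gtrdot M (Some a) (ohead u) ->
  residual n.+1 ((a, p) :: st, q, u) =
  \sum_(r | (q, p, r) \in delta_pop A)
    wt_pop (q, p, r) * residual n (st, r, u).
Proof.
rewrite /gtrdot /= => /eqP ->.
by rewrite big_map big_filter big_enum_cond /= add0r.
Qed.

Lemma residual_stuck n st q u : (st, u) <> ([::], [::]) ->
  M (top st) (ohead u) = None -> residual n (st, q, u) = 0.
Proof.
case: n => [|n] ne no; first exact: residual0.
by rewrite /= no big_nil addr0; case: st u ne no => [|? ?] [|? ?].
Qed.

End Residual.

Arguments residual {K Sigma} M {A} n c : simpl never.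

(** * Letterwise preimages of a compatible word *)

Section Preimages.
Context {K : pzSemiRingType} {Sigma' Sigma : finType} (h : Sigma' -> Sigma).
Context (M : opm Sigma).

Lemma letter_at_map (w : seq Sigma') i :
  letter_at (map h w) i = omap h (letter_at w i).
Proof. by case: i => [|i] //=; rewrite onth_map. Qed.

(** Recursion on the derivation itself, because the inner chains occur under a disjunction. *)
Fixpoint chain_preim (w : seq Sigma') i j (c : chain M (map h w) i j) :
  chain (preim_opm h M) w i j.
Proof.
case: c => {}i x ks {}j ltw jw lt eqs gt sub; rewrite size_map in jw.
apply: (@chain_intro _ _ w i x ks j) => //.
- by rewrite /lessdot /= -!letter_at_map.
- rewrite (eq_path (e' := fun p q => doteq M (letter_at (map h w) p)
    (letter_at (map h w) q))) // => p q.
  by rewrite /doteq /= !letter_at_map.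
- by rewrite /gtrdot /= -!letter_at_map.
move=> s /sub /= [|sub']; [by left | right; exact: chain_preim].
Qed.

Lemma compatible_preim (w : seq Sigma') :
  compatible M (map h w) -> compatible (preim_opm h M) w.
Proof. by rewrite /compatible size_map; exact: chain_preim. Qed.

Fixpoint preimages (v : seq Sigma) : seq (seq Sigma') :=
  if v is b :: x then
    [seq b' :: x' | b' <- [seq b' <- enum Sigma' | h b' == b],
                    x' <- preimages x]
  else [:: [::]].

Lemma mem_preimages v w : (w \in preimages v) = (map h w == v).
Proof.
elim: v w => [|b x IHx] [|b' w] //=; first by apply/negP => /allpairsP[? []].
apply/allpairsP/eqP => [[[c y] /= [+ + [-> ->]]]|[hb hx]].
  by rewrite mem_filter IHx => /andP[/eqP -> _] /eqP ->.
by exists (b', w); rewrite /= mem_filter mem_enum IHx hb hx !eqxx.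
Qed.

Lemma uniq_preimages v : uniq (preimages v).
Proof.
elim: v => [|b x IHx] //=; apply: allpairs_uniq => //.
  exact/filter_uniq/enum_uniq.
by move=> [? ?] [? ?] _ _ [-> ->].
Qed.

Lemma big_preimages_cons b x (f : seq Sigma' -> K) :
  \sum_(w <- preimages (b :: x)) f w =
  \sum_(b' | h b' == b) \sum_(w <- preimages x) f (b' :: w).
Proof. by rewrite /= big_allpairs_dep big_filter big_enum_cond. Qed.

(** Every letterwise preimage of a compatible word is compatible, so the fiber is exactly the
    duplicate-free list [preimages v] and the sum can be taken over plain sequences. *)
Lemma series_imageE (T : series K (preim_opm h M)) (f : seq Sigma' -> K)
    (v : opword M) :
  (forall w : opword (preim_opm h M), map h w = opword_seq v ->
     T w = f (opword_seq w)) ->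
  series_image h T v = \sum_(w <- preimages v) f w.
Proof.
move=> Tf; rewrite /series_image (@eq_fsbigr _ _ _ _ T (f \o @opword_seq _ _)).
  rewrite -(@fsbig_image _ _ _ _ _ _ (@opword_seq _ _) f); last first.
    by move=> w w' _ _; exact: val_inj.
  rewrite (_ : (_ @` _)%classic = [set` preimages v]%classic).
    by rewrite -fsbig_seq // uniq_preimages.
  apply/seteqP; split.
    by move=> _ [w hw <-] /=; rewrite mem_preimages; exact/eqP.
  move=> w /=; rewrite mem_preimages => /eqP hw.
  have /andP[vn vc] := opwordP v.
  have wP : (w != [::]) && `[< compatible (preim_opm h M) w >].
    apply/andP; split; first by case: w hw vn => // <-.
    by apply/asboolP/compatible_preim; rewrite hw; exact/asboolP.
  by exists (OpWord wP).
by move=> w /set_mem; exact: Tf.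
Qed.

End Preimages.

(** * Determinization by the subset construction *)

Section SubsetConstruction.
Context {Sigma : finType} (M : opm Sigma) (C : opa Sigma).
Local Notation Q := (state C).

(* A pair (q, o) in a macrostate means that C can be in state q with o the state
   of its topmost stack symbol, [None] standing for the bottom of the stack. *)
Definition macrostate : finType := {set Q * option Q}.
Implicit Types (X Y Z : macrostate).
Implicit Type st : seq (Sigma * macrostate).
Implicit Type sq : seq (Sigma * Q).

Definition macro_init : macrostate := [set (q, None) | q in init C].

Definition macro_final X : bool := [exists q in final C, (q, None) \in X].

Definition macro_push X (b : Sigma) : macrostate :=
  [set rp | if rp.2 is Some p
            then [exists o, (p, o) \in X] && ((p, b, rp.1) \in delta_push C)
            else false].

Definition macro_shift X (b : Sigma) : macrostate :=
  [set ro | [exists q, ((q, ro.2) \in X) && ((q, b, ro.1) \in delta_shift C)]].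

(** [Y] is the macrostate stored at the push. [macro_push] forgets the symbol beneath the new top;
    the condition on [(p, ro.2)] recovers its state from [Y]. *)
Definition macro_pop X Y : macrostate :=
  [set ro | [exists q, exists p, [&& (q, Some p) \in X, (p, ro.2) \in Y
                                   & (q, p, ro.1) \in delta_pop C]]].

(** A concrete stack of [C] threaded through a stack of macrostates: at each level the state is
    paired, in the macrostate of that level, with the stack state directly beneath it. *)
Fixpoint represents st X sq (q : Q) : bool :=
  match st, sq with
  | [::], [::] => (q, None) \in X
  | (a, Y) :: s, (a', p) :: s' =>
      [&& a == a', (q, Some p) \in X & represents s Y s' p]
  | _, _ => false
  end.

Definition macro_accepts st X (u : seq Sigma) : Prop :=
  exists sq q, represents st X sq q /\ accepts M (sq, q, u).


Lemma top_represents st X sq q :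
  represents st X sq q -> top sq = ohead (map fst st).
Proof.
by case: st sq => [|[a Y] st] [|[a' p] sq] //= /andP[/eqP <-].
Qed.

Lemma represents_mem st X sq q : represents st X sq q ->
  (q, ohead (map snd sq)) \in X.
Proof.
by case: st sq => [|[a Y] st] [|[a' p] sq] //= /and3P[].
Qed.

(** Only the topmost pair is tested against the current macrostate, so state and macrostate can be
    exchanged above an unchanged stack. *)
Lemma represents_change st X Y sq q r : represents st X sq q ->
  represents st Y sq r = ((r, ohead (map snd sq)) \in Y).
Proof.
by case: st sq => [|[a Z] st] [|[a' p] sq] //= /and3P[-> _ ->]; rewrite andbT.
Qed.

Lemma macro_accepts_end X : macro_accepts [::] X [::] <-> macro_final X.
Proof.
split=> [[[|? ?] [q [//= qX acc]]]|/exists_inP[q qf qX]].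
  by apply/exists_inP; exists q => //; move/accepts_end: acc.
by exists [::], q; split=> //; apply/accepts_end.
Qed.

(** Determinism: the choice of a target in [C] is absorbed into a single successor macrostate. The
    same holds for shifts and pops below. *)
Lemma macro_accepts_push st X b x :
  lessdot M (ohead (map fst st)) (Some b) ->
  macro_accepts st X (b :: x) <->
  macro_accepts ((b, X) :: st) (macro_push X b) x.
Proof.
move=> lt; split=> [[sq [q [rep]]]|].
  rewrite accepts_push ?(top_represents rep) // => -[r qr acc].
  exists ((b, q) :: sq), r; split=> //=; rewrite eqxx rep andbT inE /= qr andbT.
  by apply/existsP; exists (ohead (map snd sq)); exact: represents_mem rep.
move=> [[|[b' q] sq] [r [//= /and3P[/eqP <- + rep] acc]]].
rewrite inE /= => /andP[_ qr]; exists sq, q; split=> //.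
by rewrite accepts_push ?(top_represents rep) //; exists r.
Qed.

Lemma macro_accepts_shift a Y st X b x : doteq M (Some a) (Some b) ->
  macro_accepts ((a, Y) :: st) X (b :: x) <->
  macro_accepts ((b, Y) :: st) (macro_shift X b) x.
Proof.
move=> eq; split=> [[[|[a' p] sq] [q [//= /and3P[/eqP <- qX rep]]]]|].
  rewrite accepts_shift // => -[r qr acc].
  exists ((b, p) :: sq), r; split=> //=; rewrite eqxx rep andbT inE /=.
  by apply/existsP; exists q; rewrite qX.
move=> [[|[b' p] sq] [r [//= /and3P[/eqP <- + rep] acc]]].
rewrite inE /= => /existsP[q /andP[qX qr]].
exists ((a, p) :: sq), q; split=> /=; first by rewrite eqxx qX.
by rewrite accepts_shift //; exists r.
Qed.

Lemma macro_accepts_pop a Y st X u : gtrdot M (Some a) (ohead u) ->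
  macro_accepts ((a, Y) :: st) X u <-> macro_accepts st (macro_pop X Y) u.
Proof.
move=> gt; split=> [[[|[a' p] sq] [q [//= /and3P[/eqP <- qX rep]]]]|].
  rewrite accepts_pop // => -[r qr acc].
  exists sq, r; split=> //; rewrite (represents_change _ _ rep) inE /=.
  apply/existsP; exists q; apply/existsP; exists p.
  by rewrite qX qr (represents_mem rep).
(* The pair witnessing [r] names a state [p] that fits in [Y] above the actual top of [sq], so
   [(a, p)] can be put back on that very stack. *)
move=> [sq [r [rep acc]]]; have := represents_mem rep.
rewrite inE /= => /existsP[q /existsP[p /and3P[qX pY qr]]].
exists ((a, p) :: sq), q; split=> /=.
  by rewrite eqxx qX (represents_change _ _ rep).
by rewrite accepts_pop //; exists r.
Qed.

Lemma language_macro (w : opword M) :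
  language M C w <-> macro_accepts [::] macro_init w.
Proof.
rewrite languageP; split=> [[q qi acc]|[[|? ?] [q [//= qX acc]]]].
  by exists [::], q; split=> //=; apply/imsetP; exists q.
by case/imsetP: qX acc => q' qi [->] acc; exists q'.
Qed.

End SubsetConstruction.

(** * From the Nivat class to a restricted weighted automaton *)

Lemma big_eq_op (R : nmodType) (I : finType) (j : I) (c : bool) (F : I -> R) :
  \sum_(i | (i == j) && c) F i = if c then F j else 0.
Proof.
case: c; first by under eq_bigl do rewrite andbT; rewrite big_pred1_eq.
by rewrite big_pred0 // => i; rewrite andbF.
Qed.

Lemma big_singleton (R : nmodType) (I : finType) (j : I) (P : pred I)
    (F : I -> R) :
  (forall i, i = j) -> \sum_(i | P i) F i = if P j then F j else 0.
Proof.
move=> all_j; rewrite -(big_eq_op j); apply: eq_bigl => i.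
by rewrite (all_j i) eqxx.
Qed.

Lemma preim_top (Sigma' Sigma : finType) (h : Sigma' -> Sigma) (M : opm Sigma)
    (T' T : Type) (s' : seq (Sigma' * T')) (s : seq (Sigma * T)) u' :
  map h (map fst s') = map fst s ->
  preim_opm h M (ohead (map fst s')) (ohead u') =
  M (ohead (map fst s)) (ohead (map h u')).
Proof. by move=> <-; case: s' u' => [|? ?] [|? ?]. Qed.

Section NivatToAutomaton.
Context {K : pzSemiRingType} {Sigma' Sigma : finType} (h : Sigma' -> Sigma).
Context (M : opm Sigma) (B : wopa K Sigma') (b0 : state B) (C : opa Sigma').
Hypothesis state_b0 : forall b : state B, b = b0.
Hypothesis restrB : restricted B.
Local Notation M' := (preim_opm h M).

(** Pushes and shifts are all allowed: the weights defined next vanish as empty sums where no letter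
    realizes the transition. Pops always weigh 1, so they have to be restricted here. *)
Definition nivat_opa : opa Sigma := @Opa Sigma (macrostate C)
  [set X | (X == macro_init C) && (b0 \in init B)]
  [set X | macro_final X && (b0 \in final B)]
  [set: _]%SET [set: _]%SET
  [set t | (t.2 == macro_pop t.1.1 t.1.2) && ((b0, b0, b0) \in delta_pop B)].

Definition nivat_wopa : wopa K Sigma := @Wopa K Sigma nivat_opa
  (fun t => \sum_(b' | [&& h b' == t.1.2, t.2 == macro_shift t.1.1 b'
                         & (b0, b', b0) \in delta_shift B])
              wt_shift (b0, b', b0))
  (fun t => \sum_(b' | [&& h b' == t.1.2, t.2 == macro_push t.1.1 b'
                         & (b0, b', b0) \in delta_push B])
              wt_push (b0, b', b0))
  (fun=> 1).

Local Notation stackA st :=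
  ([seq (h e.1, e.2) | e <- st] : seq (Sigma * state nivat_opa)).
Local Notation stackB st := ([seq (e.1, b0) | e <- st] : seq (Sigma' * state B)).

(** The stack keeps the letters of [Sigma'] chosen so far; the new automaton sees only their images
    and macrostates, and [B] only the letters. As [h] preserves precedence, all three make the same
    kind of move. *)
Lemma residual_nivat_wopa n (st : seq (Sigma' * macrostate C))
    (X : macrostate C) (u : seq Sigma) :
  residual M (A := nivat_wopa) n (stackA st, X, u) =
  \sum_(u' <- preimages h u)
     if `[< macro_accepts M' st X u' >]
     then residual M' (A := B) n (stackB st, b0, u') else 0.
Proof.
elim: n st X u => [|n IHn] st X u.
all: have [[-> ->]|ne] := EM ((st, u) = ([::], [::])).
- rewrite big_seq1 !residual_end (asbool_equiv_eq (macro_accepts_end _ _)).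
  by rewrite asboolb inE; case: macro_final.
- rewrite residual0; last by case: st u ne => [|? ?] [|? ?].
  rewrite big1_seq // => u' /andP[_]; rewrite mem_preimages => /eqP hu'.
  rewrite residual0 ?if_same // => -[st0 u0]; apply: ne.
  by rewrite -hu' u0; case: (st) st0.
- rewrite big_seq1 !residual_end (asbool_equiv_eq (macro_accepts_end _ _)).
  by rewrite asboolb inE; case: macro_final.
have top_st (T : Type) (f : Sigma' * macrostate C -> T) :
  map fst [seq (e.1, f e) | e <- st] = map fst st.
  by rewrite -map_comp; exact: eq_map.
have precE (u' : seq Sigma') :
    M' (ohead (map fst st)) (ohead u') = M (top (stackA st)) (ohead (map h u')).
  by apply: preim_top; rewrite -!map_comp; exact: eq_map.
case E: (M (top (stackA st)) (ohead u)) => [[]|].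
- case: u E precE ne => [|b x] E precE ne.
    by case: st E ne {precE top_st} => [|[a Y] st]; rewrite /= ?opm_delim_right.
  rewrite residual_push ?/lessdot ?E // big_preimages_cons.
  under eq_bigr do rewrite mulr_suml /=.
  (* Summing over letters first leaves one target for each letter, namely [macro_push X b']. *)
  rewrite (exchange_big_dep (fun b' => h b' == b)) /=; last first.
    by move=> r b' _ /and3P[].
  apply: eq_bigr => b' hb'.
  under eq_bigl do rewrite inE hb' /=.
  rewrite big_eq_op.
  have E' : lessdot M' (ohead (map fst st)) (Some b').
    by rewrite /lessdot (precE [:: b']) /= (eqP hb') E.
  under eq_bigr do
    rewrite residual_push /top ?top_st // (big_singleton _ _ state_b0).
  case: ifP => b'd; last by rewrite big1 // => x' _; rewrite if_same.
  (* Writing [b] as [h b'] exhibits the new stack as the image of one carrying [b']. *)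
  rewrite -(eqP hb') (IHn ((b', X) :: st)) mulr_sumr.
  apply: eq_bigr => x' _; rewrite (asbool_equiv_eq (macro_accepts_push _ _ E')).
  by case: ifP; rewrite ?mulr0.
- case: st u E precE ne top_st => [|[a Y] st] [|b x] E precE ne top_st //;
    rewrite ?opm_delim_right ?opm_delim_left // in E.
  rewrite residual_shift ?/doteq ?E // big_preimages_cons.
  under eq_bigr do rewrite mulr_suml /=.
  rewrite (exchange_big_dep (fun b' => h b' == b)) /=; last first.
    by move=> r b' _ /and3P[].
  apply: eq_bigr => b' hb'.
  under eq_bigl do rewrite inE hb' /=.
  rewrite big_eq_op.
  have E' : doteq M' (Some a) (Some b').
    by rewrite /doteq (precE [:: b']) /= (eqP hb') E.
  under eq_bigr do
    rewrite residual_shift // (big_singleton _ _ state_b0).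
  case: ifP => b'd; last by rewrite big1 // => x' _; rewrite if_same.
  rewrite -(eqP hb') (IHn ((b', Y) :: st)) mulr_sumr.
  apply: eq_bigr => x' _.
  rewrite (asbool_equiv_eq (macro_accepts_shift _ _ _ _ E')).
  by case: ifP; rewrite ?mulr0.
- case: st E precE ne top_st => [|[a Y] st] E precE ne top_st.
    by case: u E ne {precE} => [|b x]; rewrite /= ?opm_delim_left.
  rewrite residual_pop ?/gtrdot ?E //.
  under eq_bigl do rewrite inE /=.
  rewrite big_eq_op mul1r IHn.
  transitivity (\sum_(u' <- preimages h u)
    if (b0, b0, b0) \in delta_pop B then
      if `[< macro_accepts M' st (macro_pop X Y) u' >]
      then residual M' n (stackB st, b0, u') else 0 else 0).
    by case: ifP => _ //; rewrite big1.
  apply: eq_big_seq => u'; rewrite mem_preimages => /eqP hu'.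
  have E' : gtrdot M' (Some a) (ohead u') by rewrite /gtrdot precE hu' E.
  rewrite residual_pop // (big_singleton _ _ state_b0).
  rewrite (asbool_equiv_eq (macro_accepts_pop _ _ _ E')).
  by case: ifP => [bd|_]; rewrite ?if_same // restrB // mul1r.
- rewrite residual_stuck //; last first.
    by move=> [st0 u0]; apply: ne; rewrite u0; case: (st) st0.
  rewrite big1_seq // => u' /andP[_].
  rewrite mem_preimages => /eqP hu'.
  rewrite residual_stuck ?if_same //.
    move=> [st0 u0]; apply: ne; rewrite -hu' u0.
    by case: (st) st0.
  by rewrite /top top_st precE hu'.
Qed.

Lemma behavior_nivat_wopa :
  behavior M nivat_wopa =
  series_image h (series_restr (behavior M' B) (language M' C)).
Proof.
apply/funext => v; pose n := (size v).*2.
rewrite (@series_imageE _ _ _ h M _ (fun w =>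
    if `[< macro_accepts M' [::] (macro_init C) w >] then
      if b0 \in init B then residual M' (A := B) n ([::], b0, w) else 0
    else 0)); last first.
  move=> w hw; rewrite /series_restr (asbool_equiv_eq (language_macro C w)).
  by rewrite behaviorE (big_singleton _ _ state_b0) /n -hw size_map.
rewrite behaviorE.
under eq_bigl do rewrite inE.
rewrite big_eq_op (residual_nivat_wopa n [::]).
by case: ifP => _ //; rewrite big1 // => w _; rewrite if_same.
Qed.

End NivatToAutomaton.

(** * From a restricted weighted automaton to the Nivat class *)

Lemma big_inj_support (R : nmodType) (I J : finType) (f : J -> I)
    (P : pred I) (Q : pred J) (F : I -> R) :
  injective f -> (forall j, Q j -> P (f j)) ->
  (forall i, P i -> F i != 0 -> exists2 j, Q j & i = f j) ->
  \sum_(i | P i) F i = \sum_(j | Q j) F (f j).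
Proof.
move=> f_inj QP supp.
rewrite -(big_imset (A := [pred j | Q j]) _ (h := f)) /=; last first.
  by move=> x y _ _; exact: f_inj.
rewrite big_mkcond [RHS]big_mkcond; apply: eq_bigr => i _.
case: imsetP => [[j Qj ->]|notQ]; first by rewrite QP.
case: ifP => // Pi; apply/eqP/negPn/negP => /(supp _ Pi)[j Qj iE].
by apply: notQ; exists j.
Qed.

Section AutomatonToNivat.
Context {K : pzSemiRingType} {Sigma : finType} (M : opm Sigma).
Context (A : wopa K Sigma).
Hypothesis restrA : restricted A.
Local Notation Q := (state A).

(* A letter is a push or shift transition of A; on a push it also carries the
   target of the pop that later removes the pushed symbol, so that a word over
   these letters determines a run. *)
Definition letter : finType := (Q * Sigma * Q * option Q)%type.
Implicit Types (l : letter) (w : seq letter).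

Definition letter_proj l : Sigma := l.1.1.2.
Local Notation h := letter_proj.
Local Notation M' := (preim_opm h M).

(** Everything is permitted and each letter weighs as much as the transition it records; selecting
    the words that encode runs is left to [run_opa]. *)
Definition letter_wopa : wopa K letter :=
  @Wopa K letter (@Opa letter unit [set: unit]%SET [set: unit]%SET
                   [set: _]%SET [set: _]%SET [set: _]%SET)
    (fun t => wt_shift t.1.2.1) (fun t => wt_push t.1.2.1) (fun=> 1).

(* The second component of a state guesses the annotation of the next letter to
   be pushed; it is then stored on the stack and checked by the pop. *)
Definition run_opa : opa letter := @Opa letter (Q * Q)%type
  [set q | q.1 \in init A]
  [set q | q.1 \in final A]
  [set t | [&& t.1.2.2 == None, t.1.2.1.1.1 == t.1.1.1, t.1.2.1.2 == t.2.1
             & t.1.2.1 \in delta_shift A]]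
  [set t | [&& t.1.2.2 == Some t.1.1.2, t.1.2.1.1.1 == t.1.1.1,
               t.1.2.1.2 == t.2.1 & t.1.2.1 \in delta_push A]]
  [set t | (t.2.1 == t.1.2.2) && ((t.1.1.1, t.1.2.1, t.2.1) \in delta_pop A)].

Implicit Type st : seq (letter * (Q * Q)).

(** The current guess is quantified away, since the next pushed letter determines it. *)
Definition run_accepts st (q : Q) w : Prop :=
  exists g, accepts M' (A := run_opa) (st, (q, g), w).

Lemma run_accepts_end q : run_accepts [::] q [::] <-> q \in final A.
Proof.
split=> [[g /accepts_end]|qf]; first by rewrite inE.
by exists q; apply/accepts_end; rewrite inE.
Qed.

Lemma run_accepts_push st q l w :
  lessdot M' (ohead (map fst st)) (Some l) ->
  run_accepts st q (l :: w) <->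
  exists r t, [/\ l = (q, h l, r, Some t), (q, h l, r) \in delta_push A
                & run_accepts ((l, (q, t)) :: st) r w].
Proof.
move=> lt; split=> [[g]|[r [t [lE ld [g acc]]]]].
  rewrite accepts_push // => -[[r g'] + acc]; rewrite inE /=.
  case: l lt acc => [[[q' b] r'] o] lt acc /=.
  case/and4P=> /eqP oE /eqP q'E /eqP r'E ld; subst.
  by exists r, g; split=> //; exists g'.
(* The guess before the push is the target [t] announced by the letter; [g] serves the rest of the
   word. *)
exists t; rewrite accepts_push //; exists (r, g) => //.
by rewrite lE inE /= !eqxx.
Qed.

Lemma run_accepts_shift st a p q l w : doteq M' (Some a) (Some l) ->
  run_accepts ((a, p) :: st) q (l :: w) <->
  exists r, [/\ l = (q, h l, r, None), (q, h l, r) \in delta_shift A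
              & run_accepts ((l, p) :: st) r w].
Proof.
move=> eq; split=> [[g]|[r [lE ld [g acc]]]].
  rewrite accepts_shift // => -[[r g'] + acc]; rewrite inE /=.
  case: l eq acc => [[[q' b] r'] o] eq acc /=.
  case/and4P=> /eqP oE /eqP q'E /eqP r'E ld; subst.
  by exists r; split=> //; exists g'.
(* Any guess may precede a shift, which can replace it by [g]. *)
exists q; rewrite accepts_shift //; exists (r, g) => //.
by rewrite lE inE /= !eqxx.
Qed.

Lemma run_accepts_pop st a p t q w : gtrdot M' (Some a) (ohead w) ->
  run_accepts ((a, (p, t)) :: st) q w <->
  (q, p, t) \in delta_pop A /\ run_accepts st t w.
Proof.
move=> gt; split=> [[g]|[ld [g acc]]].
  rewrite accepts_pop // => -[[r g'] + acc]; rewrite inE /=.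
  by case/andP=> /eqP rE ld; subst; split=> //; exists g'.
exists q; rewrite accepts_pop //; exists (t, g) => //.
by rewrite inE /= eqxx.
Qed.

Lemma language_run (w : opword M') :
  language M' run_opa w <-> exists2 q, q \in init A & run_accepts [::] q w.
Proof.
rewrite languageP; split=> [[[q g]]|[q qi [g acc]]].
  by rewrite inE => qi acc; exists q => //; exists g.
by exists (q, g); rewrite ?inE.
Qed.

(* An entry (a, p, f) stands for a symbol a, pushed from state p, whose letter
   with annotation t is f t. *)
Implicit Type sf : seq (Sigma * Q * (Q -> letter)).

(** All stacks of [run_opa] over a given stack of [A], one for each choice of announced pop targets.
    After a shift the letter no longer shows the target, but the stack state still holds it. *)
Fixpoint annotations sf : seq (seq (letter * (Q * Q))) :=
  if sf is (a, p, f) :: sf' then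
    [seq (f t, (p, t)) :: st | t <- enum Q, st <- annotations sf']
  else [:: [::]].

Definition well_projected sf : bool :=
  all (fun e => [forall t, h (e.2 t) == e.1.1]) sf.

Local Notation stackB st :=
  ([seq (e.1, tt) | e <- st] : seq (letter * state letter_wopa)).

Lemma annotations_fst sf st : well_projected sf -> st \in annotations sf ->
  map h (map fst st) = map fst (map fst sf).
Proof.
elim: sf st => [|[[a p] f] sf IHsf] st /=; first by rewrite inE => _ /eqP ->.
move=> /andP[/forallP hf wsf] /allpairsP[[t st'] /= [_ st'in ->]] /=.
by rewrite (eqP (hf t)) IHsf.
Qed.

(** [A] has not yet chosen the pop targets of its stack symbols, whereas the letters have announced
    them; hence the sum over annotations. Each accepting run of [A] realizes exactly one annotation
    and one word. *)
Lemma residual_run n sf (q : Q) (u : seq Sigma) : well_projected sf ->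
  residual M n (map fst sf, q, u) =
  \sum_(st <- annotations sf) \sum_(w <- preimages h u)
    if `[< run_accepts st q w >]
    then residual M' (A := letter_wopa) n (stackB st, tt, w) else 0.
Proof.
have end_case m q' : residual M m ([::], q', [::]) =
  \sum_(st <- annotations [::]) \sum_(w <- preimages h [::])
    if `[< run_accepts st q' w >]
    then residual M' (A := letter_wopa) m (stackB st, tt, w) else 0.
  rewrite !big_seq1 !residual_end (asbool_equiv_eq (run_accepts_end _)).
  by rewrite asboolb inE.
have neB sf' st u' w : (sf', u') <> ([::], [::]) -> well_projected sf' ->
    st \in annotations sf' -> map h w = u' -> (stackB st, w) <> ([::], [::]).
  move=> ne wsf' /(annotations_fst wsf') hst hw [st0 w0]; apply: ne.
  rewrite -hw w0; case: st st0 hst => // _ {wsf'}.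
  by case: sf' => [|[[]]].
elim: n sf q u => [|n IHn] sf q u wsf.
all: have [[-> ->]|ne] := EM ((sf, u) = ([::], [::])); first exact: end_case.
  rewrite residual0; last first.
    by move=> [sf0 u0]; apply: ne; rewrite u0; case: (sf) sf0.
  rewrite big1_seq // => st /andP[_ stin]; rewrite big1_seq // => w /andP[_].
  rewrite mem_preimages => /eqP hw.
  by rewrite residual0 ?if_same //; exact: neB stin hw.
have top_st (st : seq (letter * (Q * Q))) :
    map fst (stackB st) = map fst st by rewrite -map_comp; exact: eq_map.
have precE st w : st \in annotations sf ->
    M' (ohead (map fst st)) (ohead w) =
    M (top (map fst sf)) (ohead (map h w)).
  by move=> stin; exact/preim_top/annotations_fst.
have all_tt : forall i : unit, i = tt by case.
case E: (M (top (map fst sf)) (ohead u)) => [[]|].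
- case: u E ne => [|b x] E ne.
    by case: sf E ne {wsf precE} => [|[[a p] f] sf]; rewrite /= ?opm_delim_right.
  have lt st l : st \in annotations sf -> h l = b ->
      lessdot M' (ohead (map fst st)) (Some l).
    by move=> stin hl; rewrite /lessdot (precE _ [:: l]) //= hl E.
  rewrite residual_push ?/lessdot ?E //.
  (* Only first letters recording a push of [A] from [q] on [b] contribute; their announced target
     is free and becomes the annotation of the new stack entry. *)
  transitivity (\sum_(st <- annotations sf)
    \sum_(rt : Q * Q | (q, b, rt.1) \in delta_push A)
    \sum_(w <- preimages h x)
      if `[< run_accepts st q ((q, b, rt.1, Some rt.2) :: w) >]
      then residual M' (A := letter_wopa) n.+1
             (stackB st, tt, (q, b, rt.1, Some rt.2) :: w)
      else 0); last first.
    apply: eq_big_seq => st stin; rewrite big_preimages_cons.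
    rewrite (@big_inj_support _ _ _
      (fun rt : Q * Q => (q, b, rt.1, Some rt.2) : letter) _
      (fun rt => (q, b, rt.1) \in delta_push A)) //.
      by move=> [r t] [r' t'] [-> ->].
    move=> l /eqP hl; have [//|noex /eqP[]] :=
      EM (exists2 rt : Q * Q, (q, b, rt.1) \in delta_push A
                            & l = (q, b, rt.1, Some rt.2)).
    rewrite big1 // => w _; case: asboolP => // acc; case: noex.
    move: acc; rewrite run_accepts_push ?lt // => -[r [t [-> ld _]]].
    by exists (r, t); rewrite -?hl.
  rewrite exchange_big (eq_bigl (fun rt : Q * Q =>
    ((q, b, rt.1) \in delta_push A) && predT rt.2)) /=; last first.
    by move=> rt; rewrite andbT.
  rewrite -(pair_big (fun r => (q, b, r) \in delta_push A) predT
    (fun r t => \sum_(st <- annotations sf) \sum_(w <- preimages h x)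
      if `[< run_accepts st q ((q, b, r, Some t) :: w) >]
      then residual M' (A := letter_wopa) n.+1
             (stackB st, tt, (q, b, r, Some t) :: w)
      else 0)) /=.
  apply: eq_bigr => r rd.
  rewrite (IHn ((b, q, fun t => (q, b, r, Some t)) :: sf)); last first.
    by rewrite /= wsf andbT; apply/forallP => t; rewrite eqxx.
  rewrite big_allpairs_dep big_enum mulr_sumr; apply: eq_bigr => t _ /=.
  rewrite mulr_sumr; apply: eq_big_seq => st stin.
  rewrite mulr_sumr; apply: eq_bigr => w _.
  have lt_st := lt st (q, b, r, Some t) stin erefl.
  rewrite residual_push /top ?top_st // (big_singleton _ _ all_tt) finset.in_setT.
  suff -> : `[< run_accepts st q ((q, b, r, Some t) :: w) >] =
    `[< run_accepts (((q, b, r, Some t), (q, t)) :: st) r w >].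
    by case: asboolP; rewrite ?mulr0.
  apply: asbool_equiv_eq; rewrite run_accepts_push //.
  by split=> [[r' [t' [[<- <-] _]]]|acc] //; exists r, t.
- case: sf u wsf E ne precE => [|[[a p] f] sf] [|b x] wsf E ne precE //;
    rewrite /= ?opm_delim_right ?opm_delim_left // in E.
  have hf : forall t, h (f t) == a by apply/forallP; case/andP: wsf.
  have wsf' : well_projected sf by case/andP: wsf.
  have eq t l : h l = b -> doteq M' (Some (f t)) (Some l).
    by move=> hl; rewrite /doteq /= (eqP (hf t)) hl E.
  rewrite residual_shift ?/doteq ?E //.
  rewrite [annotations _]/= big_allpairs_dep big_enum /=.
  transitivity (\sum_t \sum_(st <- annotations sf)
    \sum_(r | (q, b, r) \in delta_shift A) \sum_(w <- preimages h x)
      if `[< run_accepts ((f t, (p, t)) :: st) q ((q, b, r, None) :: w) >]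
      then residual M' (A := letter_wopa) n.+1
             ((f t, tt) :: stackB st, tt, (q, b, r, None) :: w)
      else 0); last first.
    apply: eq_bigr => t _; apply: eq_bigr => st _; rewrite big_preimages_cons.
    rewrite (@big_inj_support _ _ _ (fun r : Q => (q, b, r, None) : letter) _
      (fun r => (q, b, r) \in delta_shift A)) //.
      by move=> r r' [->].
    move=> l /eqP hl; have [//|noex /eqP[]] :=
      EM (exists2 r : Q, (q, b, r) \in delta_shift A & l = (q, b, r, None)).
    rewrite big1 // => w _; case: asboolP => // acc; case: noex.
    move: acc; rewrite run_accepts_shift ?eq // => -[r [-> ld _]].
    by exists r; rewrite -?hl.
  under [RHS]eq_bigr do rewrite exchange_big /=.
  rewrite exchange_big /=; apply: eq_bigr => r rd.
  (* The shifted letter does not depend on the announced target, hence the constant function. *)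
  rewrite (IHn ((b, p, fun=> (q, b, r, None)) :: sf)); last first.
    by rewrite /= wsf' andbT; apply/forallP => t; rewrite eqxx.
  rewrite big_allpairs_dep big_enum mulr_sumr; apply: eq_bigr => t _ /=.
  rewrite mulr_sumr; apply: eq_bigr => st _.
  rewrite mulr_sumr; apply: eq_bigr => w _.
  have eq_st := eq t (q, b, r, None) erefl.
  rewrite residual_shift // (big_singleton _ _ all_tt) finset.in_setT.
  suff -> : `[< run_accepts ((f t, (p, t)) :: st) q ((q, b, r, None) :: w) >] =
    `[< run_accepts (((q, b, r, None), (p, t)) :: st) r w >].
    by case: asboolP; rewrite ?mulr0.
  apply: asbool_equiv_eq; rewrite run_accepts_shift //.
  by split=> [[r' [[<-] _]]|acc] //; exists r.
- case: sf wsf E ne precE => [|[[a p] f] sf] wsf E ne precE.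
    by case: u E ne => [|b x]; rewrite /= ?opm_delim_left.
  have hf : forall t, h (f t) == a by apply/forallP; case/andP: wsf.
  have wsf' : well_projected sf by case/andP: wsf.
  rewrite residual_pop ?/gtrdot ?E //.
  (* The announced target of the top entry is matched with the target of the pop of [A]: both sides
     become sums over all [t]. *)
  rewrite [annotations _]/= big_allpairs_dep big_enum /= big_mkcond /=.
  apply: eq_bigr => t _.
  transitivity (\sum_(st <- annotations sf) \sum_(w <- preimages h u)
    if (q, p, t) \in delta_pop A then
      if `[< run_accepts st t w >]
      then residual M' (A := letter_wopa) n (stackB st, tt, w) else 0
    else 0).
    case: ifP => [ld|_]; first by rewrite restrA // mul1r IHn.
    by rewrite big1 // => st _; rewrite big1.
  apply: eq_bigr => st _; apply: eq_big_seq => w.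
  rewrite mem_preimages => /eqP hw.
  have gt : gtrdot M' (Some (f t)) (ohead w).
    by rewrite /gtrdot -E -hw /= (eqP (hf t)); case: (w).
  rewrite residual_pop // (big_singleton _ _ all_tt) finset.in_setT mul1r.
  rewrite (asbool_equiv_eq (run_accepts_pop _ _ _ _ gt)) asbool_and asboolb.
  by case: ifP.
- rewrite residual_stuck //; last first.
    by move=> [sf0 u0]; apply: ne; rewrite u0; case: (sf) sf0.
  rewrite big1_seq // => st /andP[_ stin]; rewrite big1_seq // => w /andP[_].
  rewrite mem_preimages => /eqP hw.
  rewrite residual_stuck ?if_same //; first exact: neB stin hw.
  by rewrite /top top_st precE // hw.
Qed.

Lemma behavior_letter_wopa :
  behavior M A =
  series_image h (series_restr (behavior M' letter_wopa) (language M' run_opa)).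
Proof.
apply/funext => v; pose n := (size v).*2.
rewrite (@series_imageE _ _ _ h M _ (fun w =>
    if `[< exists2 q, q \in init A & run_accepts [::] q w >]
    then residual M' (A := letter_wopa) n ([::], tt, w) else 0)); last first.
  move=> w hw; rewrite /series_restr (asbool_equiv_eq (language_run w)).
  rewrite behaviorE (@big_singleton _ _ tt) ?finset.in_setT; last by case.
  by rewrite /n -hw size_map.
rewrite behaviorE.
under eq_bigr do rewrite (residual_run _ (sf := [::])) // big_seq1.
(* For a fixed [w], the sum over initial states of [A] must collapse to one term, because
   [letter_wopa] has a single initial state. *)
rewrite exchange_big; apply: eq_big_seq => w; rewrite mem_preimages => /eqP hw.
case: asboolP => [[q qi acc]|noacc]; last first.
  by rewrite big1 // => q qi; case: asboolP => // acc; case: noacc; exists q.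
(* The first letter of w is pushed, hence it records the initial state. *)
have start q' : run_accepts [::] q' w -> q' = (head q [seq l.1.1.1 | l <- w]).
  case: w hw {acc} => [|l w] hw.
    by have := opwordP v; rewrite -hw.
  rewrite run_accepts_push; last by rewrite /lessdot /= opm_delim_left.
  by move=> [r [t [-> _ _]]].
rewrite (bigD1 q) //= asboolT // big1 ?addr0 // => q' /andP[_ /eqP q'q].
by case: asboolP => // acc'; case: q'q; rewrite (start _ acc') -(start _ acc).
Qed.

End AutomatonToNivat.

(** * The equivalence, from the two constructions *)

Theorem theorem15 (K : pzSemiRingType) (Sigma : finType) (M : opm Sigma)
    (S : series K M) :
  strictly_regular S <-> nivat S.
Proof.
split=> [[A [restrA ->]]|].
  exists (letter A), (@letter_proj _ _ A), (letter_wopa A).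
  exists (language (preim_opm (@letter_proj _ _ A) M) (run_opa A)).
  split; rewrite ?card_unit //; first by exists (run_opa A).
  exact: behavior_letter_wopa.
move=> [Sigma' [h [B [L [restrB /eqP cardB [C ->] ->]]]]].
have /fintype1P[b0 state_b0] : #|state B| == 1%N := cardB.
exists (nivat_wopa h b0 C); split=> //.
by rewrite behavior_nivat_wopa.
Qed.
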